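(* For every integer $n\ge 0$, the map $g:\mathrm{MOT}_3(n)\rightarrow \mathrm{SCH}_{\mathrm{odd}}(n+1)$ (defined in the context) is a bijection.
   Context: A lattice path of length $n$ is a sequence of points in $\mathbb{N}\times\mathbb{N}$ (with $0\in\mathbb{N}$) starting at $(0,0)$ and ending at $(n,0)$. For a lattice path $((x_0,y_0),\dots,(x_k,y_k))$, each $S_i=(x_i-x_{i-1},y_i-y_{i-1})$ is a step, and the height of $S_i$ is $y_{i-1}$. A lattice path is identified with the word $S_1S_2\cdots S_k$ of its steps. Let $U=(1,1)$, $D=(1,-1)$, $H=(1,0)$, and let $H_i$ denote a horizontal step $H$ carrying the label $i$. $\mathrm{MOT}_3(n)$ is the set of 3-Motzkin paths of length $n$, i.e. lattice paths of length $n$ consisting of steps $U,D,H_0,H_1,H_2$ (with no further restriction on labels). A Schröder path is a lattice path consisting of steps $U$, $D$ and $H^2=(2,0)$ (where $H^2$ is a single step). A peak of a Schröder path $S_1\cdots S_k$ is a pair $(S_i,S_{i+1})$ of consecutive steps with $S_i=U$ and $S_{i+1}=D$; the height of the peak is the height of $S_{i+1}$. $\mathrm{SCH}_{\mathrm{odd}}(n)$ is the set of Schröder paths of length $2n$ which have no peaks of odd height. The map $g$: for $L\in\mathrm{MOT}_3(n)$, $g(L)$ is the lattice path obtained from $L$ by doing the following in order. (1) Change each $U$ to $UU$, each $D$ to $DD$, each $H_0$ to $H^2$, each $H_1$ to $DU$, and each $H_2$ to $UD$. (2) Add $U$ at the beginning and $D$ at the end. (3) Change all the consecutive steps $UD$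 which form a peak of odd height to $H^2$. (After step (1) alone the sequence of steps may go below the $x$-axis; after step (2) it does not.) *)

(* Defs.v *)
From mathcomp Require Import all_boot all_order all_algebra.
From mathcomp Require Import boolp classical_sets functions.
Set Implicit Arguments.
Unset Strict Implicit.
Unset Printing Implicit Defensive.
Import GRing.Theory.
Local Open Scope classical_set_scope.
Local Open Scope ring_scope.

(* H i is the unit horizontal step with label i; H2 is the single step
   (2,0), distinct from two unit horizontal steps. *)
Inductive step : Type := U | D | H of 'I_3 | H2.

Definition displacement (s : step) : int * int :=
  match s with
  | U => (1, 1)
  | D => (1, -1)
  | H _ => (1, 0)
  | H2 => (2, 0)
  end.

(* Coordinates are integers because words obtained in the middle of the
   construction of g may go below the x-axis. *)
Definition points (w : seq step) : seq (int * int) :=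
  (0, 0) :: scanl (fun p s => p + displacement s) (0, 0) w.

Definition lattice_path (n : nat) (w : seq step) : Prop :=
  last (0, 0) (points w) = (n%:Z, 0)
  /\ all (fun p : int * int => (0 <= p.1) && (0 <= p.2)) (points w).

(* Steps are numbered from 0, so that step i starts at point i. *)
Definition height (w : seq step) (i : nat) : int := (nth (0, 0) (points w) i).2.

Definition motzkin_step (s : step) : bool :=
  match s with U | D | H _ => true | H2 => false end.

Definition MOT3 (n : nat) : set (seq step) :=
  [set w | lattice_path n w /\ all motzkin_step w].

Definition schroder_step (s : step) : bool :=
  match s with U | D | H2 => true | H _ => false end.

Definition peak (w : seq step) (i : nat) : Prop :=
  [/\ (i.+1 < size w)%N, nth U w i = U & nth U w i.+1 = D].

Definition peak_height (w : seq step) (i : nat) : int := height w i.+1.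

Definition SCHodd (n : nat) : set (seq step) :=
  [set w | [/\ lattice_path (2 * n) w, all schroder_step w
             & forall i, peak w i -> ~~ odd `|peak_height w i|%N]].

(* The case H2 is irrelevant: it does not occur in a 3-Motzkin path. *)
Definition expand_step (s : step) : seq step :=
  match s with
  | U => [:: U; U]
  | D => [:: D; D]
  | H i => match val i with
           | 0%N => [:: H2]
           | 1%N => [:: D; U]
           | _ => [:: U; D]
           end
  | H2 => [:: H2]
  end.

(* h is the ordinate at which w starts, so a peak at the beginning of w has
   height h + 1. *)
Fixpoint flatten_odd_peaks (h : int) (w : seq step) : seq step :=
  match w with
  | [::] => [::]
  | U :: D :: w' =>
      (if odd `|(h + 1)%R|%N then [:: H2] else [:: U; D]) ++ flatten_odd_peaks h w'
  | s :: w' => s :: flatten_odd_peaks (h + (displacement s).2) w'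
  end.

Definition g (w : seq step) : seq step :=
  flatten_odd_peaks 0 (U :: flatten (map expand_step w) ++ [:: D]).

(* Main.v *)
(** The inverse of [g] turns every [H2] at even height into a peak [UD] (of odd
    height), drops the initial [U] and the final [D], and reads the remaining
    word two units of length at a time.  This works because in
    [U :: flatten (map expand_step w) ++ [:: D]] a block boundary following a
    point of ordinate [y] of [w] has ordinate [2 y + 1]: before flattening
    every [H2] has odd height, whereas flattening creates only [H2] of even
    height. *)
Require Import Defs.
From mathcomp Require Import all_boot.
From mathcomp Require Import classical_sets functions.
From mathcomp Require Import all_algebra zify.
Set Implicit Arguments.
Unset Strict Implicit.
Unset Printing Implicit Defensive.
Import GRing.Theory.
Local Open Scope ring_scope.

(** * Recursive conditions on words: lattice paths and odd peaks *)

Definition rise (s : step) : int := (displacement s).2.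

Definition step_width (s : step) : nat := if s is H2 then 2 else 1.

Definition width (w : seq step) : nat := sumn (map step_width w).

(** Taking the ordinate in [nat] builds in the condition of staying above the axis: the only way to
    violate it is a [D] at ordinate 0. *)
Fixpoint descends_from (h : nat) (w : seq step) : bool :=
  match w with
  | [::] => h == 0%N
  | U :: w' => descends_from h.+1 w'
  | D :: w' => if h is h'.+1 then descends_from h' w' else false
  | _ :: w' => descends_from h w'
  end.

Definition starts_with_odd_peak (h : int) (w : seq step) : bool :=
  if w is U :: D :: _ then odd `|(h + 1)%R|%N else false.

Fixpoint no_odd_peak (h : int) (w : seq step) : bool :=
  if w is s :: w' then
    ~~ starts_with_odd_peak h w && no_odd_peak (h + rise s) w'
  else true.

Lemma no_odd_peak_cons (h : int) (s : step) (w : seq step) :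
  no_odd_peak h (s :: w) =
  ~~ starts_with_odd_peak h (s :: w) && no_odd_peak (h + rise s) w.
Proof. by []. Qed.

(** The condition that makes flattening reversible: in the flattened word, an [H2] of even height
    can then only come from a peak. *)
Fixpoint no_even_H2 (h : int) (w : seq step) : bool :=
  if w is s :: w' then
    (if s is H2 then odd `|h|%N else true) && no_even_H2 (h + rise s) w'
  else true.

Fixpoint unflatten (h : int) (w : seq step) : seq step :=
  if w is s :: w' then
    (if s is H2 then if odd `|h|%N then [:: H2] else [:: U; D] else [:: s])
      ++ unflatten (h + rise s) w'
  else [::].

(** The default case absorbs the closing [D], which is left alone after the last block. *)
Fixpoint contract (w : seq step) : seq step :=
  match w with
  | U :: U :: w' => U :: contract w'
  | D :: D :: w' => D :: contract w'
  | H2 :: w' => H (inord 0) :: contract w'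
  | D :: U :: w' => H (inord 1) :: contract w'
  | U :: D :: w' => H (inord 2) :: contract w'
  | _ => [::]
  end.

(** The start is an arbitrary point of the quadrant so that the induction goes through. Abscissas
    never decrease, so only the ordinate can become negative. *)
Lemma lattice_path_from (n x h : nat) (w : seq step) :
  let q := scanl (fun p s => p + displacement s) (x%:Z, h%:Z) w in
  last (x%:Z, h%:Z) q = (n%:Z, 0)
    /\ all (fun p : int * int => (0 <= p.1) && (0 <= p.2)) q
  <-> (x + width w)%N = n /\ descends_from h w.
Proof.
elim: w x h => [|s w IHw] x h /=.
  rewrite /width /= addn0; split=> [[[-> ->] _]|[-> /eqP ->]] //.
(* Whenever the step ends at a point [(k, m)] with natural coordinates, the induction hypothesis
   applies there; this fails only for [D] at ordinate 0. *)
have stepE (k m : nat) : (x%:Z, h%:Z) + displacement s = (k%:Z, m%:Z) ->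
    k = (x + step_width s)%N ->
    let p := (x%:Z, h%:Z) + displacement s in
    let q := scanl (fun p s => p + displacement s) p w in
    last p q = (n%:Z, 0) /\
      [&& 0 <= p.1, 0 <= p.2
        & all (fun p : int * int => (0 <= p.1) && (0 <= p.2)) q]
    <-> (x + width (s :: w))%N = n /\ descends_from m w.
  by move=> -> -> /=; rewrite IHw /width /= addnA.
have pairE (a b c d : int) : (a, b) + (c, d) = (a + c, b + d) by [].
rewrite -andbA; case: s stepE => [||i|] stepE.
- by apply: (stepE x.+1 h.+1) => /=; rewrite ?pairE; try congr pair; lia.
- case: h stepE => [|h] stepE.
    by split=> [[_ /and3P[_ /=]]|[]].
  by apply: (stepE x.+1 h) => /=; rewrite ?pairE; try congr pair; lia.
- by apply: (stepE x.+1 h) => /=; rewrite ?pairE; try congr pair; lia.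
- by apply: (stepE x.+2 h) => /=; rewrite ?pairE; try congr pair; lia.
Qed.

Lemma lattice_pathE (n : nat) (w : seq step) :
  lattice_path n w <-> width w = n /\ descends_from 0 w.
Proof. exact: (lattice_path_from n 0 0). Qed.

(** Index 0 is the test at the head of the word, and index [i.+1] is index [i] of the tail, started
    at the next point. *)
Lemma no_odd_peak_from (p : int * int) (w : seq step) :
  let q := p :: scanl (fun p s => p + displacement s) p w in
  (forall i, peak w i -> ~~ odd `|(nth (0, 0) q i.+1).2%R|%N)
  <-> no_odd_peak p.2 w.
Proof.
elim: w p => [|s w IHw] p /=; first by split=> // _ i [].
have -> : p.2 + rise s = (p + displacement s).2 by [].
rewrite -(rwP andP) -IHw.
split=> [odd_peaks|[ns odd_peaks] [|i]].
- split; last first.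
    by move=> i pk; apply: (odd_peaks i.+1); case: pk.
  case: s w odd_peaks {IHw} => [] // [|[] w] //= odd_peaks.
  by apply: (odd_peaks 0%N).
- by case: s w ns {IHw odd_peaks} => [||j|] [|[||k|] w] //= ns [].
- by move=> pk; apply: odd_peaks; case: pk.
Qed.

Lemma SCHoddE (n : nat) (w : seq step) :
  SCHodd n w <-> [/\ width w = (2 * n)%N, descends_from 0 w,
                     all schroder_step w & no_odd_peak 0 w].
Proof.
have peakE := no_odd_peak_from (0, 0) w.
split=> [[/lattice_pathE[? ?] ? /peakE ?]|[? ? ? /peakE ?]] //.
by split=> //; apply/lattice_pathE.
Qed.

(** * Flattening odd peaks and undoing it *)

Lemma odd_absS (h : int) : odd `|(h + 1)%R|%N = ~~ odd `|h|%N.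
Proof. lia. Qed.

Lemma flatten_odd_peaks_cons (h : int) (s : step) (w : seq step) :
  flatten_odd_peaks h (s :: w) =
  if starts_with_odd_peak h (s :: w) then H2 :: flatten_odd_peaks h (behead w)
  else s :: flatten_odd_peaks (h + rise s) w.
Proof.
case: s w => [] // [|[] w] //=.
by case: ifP => //= _; rewrite /rise /= addrK.
Qed.

(** Follows the recursion of [flatten_odd_peaks], which consumes two steps at an odd peak. *)
Lemma flatten_odd_peaks_ind (P : int -> seq step -> Prop) :
  (forall h, P h [::]) ->
  (forall h w, odd `|(h + 1)%R|%N -> P h w -> P h (U :: D :: w)) ->
  (forall h s w, starts_with_odd_peak h (s :: w) = false ->
     P (h + rise s) w -> P h (s :: w)) ->
  forall h w, P h w.
Proof.
move=> P0 Ppeak Pcons h w.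
have [m] := ubnP (size w); elim: m w h => // m IHm [|s w] h //= /ltnSE ltwm.
case pk: (starts_with_odd_peak h (s :: w)); last by apply/Pcons/IHm.
case: s w pk ltwm => [] // [|[] w] //= oddh ltwm.
by apply: Ppeak => //; apply: IHm; apply: ltnW.
Qed.

(** Only a leading [U] can be replaced, and by [H2], so an initial [D] is neither created nor lost.
    Hence whether a [U] put in front forms a peak is unaffected. *)
Lemma flatten_head_D (h : int) (w : seq step) :
  (if flatten_odd_peaks h w is D :: _ then true else false) =
  (if w is D :: _ then true else false).
Proof. by case: w => [|[||i|] [|[||j|] w]] //=; case: ifP. Qed.

Lemma unflatten_head_D (h : int) (w : seq step) :
  (if unflatten h w is D :: _ then true else false) =
  (if w is D :: _ then true else false).
Proof. by case: w => [|[||i|] w] //=; case: ifP. Qed.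

Lemma starts_with_odd_peakE (h : int) (s : step) (w : seq step) :
  starts_with_odd_peak h (s :: w) =
  [&& (if s is U then true else false), (if w is D :: _ then true else false)
    & odd `|(h + 1)%R|%N].
Proof. by case: s w => [] // [|[]]. Qed.

Lemma no_odd_peak_flatten (h : int) (w : seq step) :
  no_odd_peak h (flatten_odd_peaks h w).
Proof.
elim/flatten_odd_peaks_ind: h / w => [//|h w oddh IHw|h s w npk IHw].
  by rewrite /= oddh /= /rise /= addr0.
rewrite flatten_odd_peaks_cons npk no_odd_peak_cons.
by rewrite starts_with_odd_peakE flatten_head_D -starts_with_odd_peakE npk IHw.
Qed.

Lemma flattenK (h : int) (w : seq step) :
  no_even_H2 h w -> unflatten h (flatten_odd_peaks h w) = w.
Proof.
elim/flatten_odd_peaks_ind: h / w => [//|h w oddh IHw|h s w npk IHw].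
  rewrite /= oddh /= /rise /= addrK addr0 => /IHw ->.
  by move: oddh; rewrite odd_absS; case: odd.
rewrite flatten_odd_peaks_cons npk /= => /andP[oddh /IHw ->].
by case: s oddh {npk IHw} => //= ->.
Qed.

(** Each inserted [UD] has an even base, hence an odd top, and is flattened again; the other steps
    start no odd peak before or after the insertions. *)
Lemma unflattenK (h : int) (w : seq step) :
  no_odd_peak h w -> flatten_odd_peaks h (unflatten h w) = w.
Proof.
elim: w h => [//|s w IHw] h.
rewrite no_odd_peak_cons => /andP[npk /IHw {}IHw].
have keep : flatten_odd_peaks h (s :: unflatten (h + rise s) w) = s :: w.
  rewrite flatten_odd_peaks_cons starts_with_odd_peakE unflatten_head_D.
  by rewrite -starts_with_odd_peakE (negbTE npk) IHw.
case: s keep IHw {npk} => //= _; rewrite /rise /= addr0 => IHw.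
by case: ifP => oddh /=; rewrite ?odd_absS ?oddh /= ?addr0 IHw.
Qed.

Lemma no_even_H2_unflatten (h : int) (w : seq step) :
  no_even_H2 h (unflatten h w).
Proof.
elim: w h => [//|[||i|] w IHw] h //=.
by case: ifP => [oddh|_] /=; rewrite ?oddh /rise /= addr0 ?addrK IHw.
Qed.

(** A peak and the [H2] replacing it share their endpoints, and the top of the peak lies above
    them. *)
Lemma descends_flatten (h : nat) (w : seq step) :
  descends_from h (flatten_odd_peaks h%:Z w) = descends_from h w.
Proof.
have [m] := ubnP (size w); elim: m w h => // m IHm [|s w] h //= /ltnSE ltwm.
rewrite -/(flatten_odd_peaks h%:Z (s :: w)) flatten_odd_peaks_cons.
case pk: (starts_with_odd_peak h (s :: w)).
  by case: s w pk ltwm => [] // [|[] w] //= _ ltwm; apply/IHm/ltnW.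
case: s {pk} => [||i|]; rewrite /rise /= ?addr0.
- have -> : h%:Z + 1 = h.+1%:Z by lia.
  exact: IHm.
- case: h => // h; have -> : h.+1%:Z + -1 = h%:Z by lia.
  exact: IHm.
- exact: IHm.
- exact: IHm.
Qed.

Lemma width_flatten (h : int) (w : seq step) :
  width (flatten_odd_peaks h w) = width w.
Proof.
elim/flatten_odd_peaks_ind: h / w => [//|h w oddh IHw|h s w npk IHw].
  by rewrite /= oddh /width /= -/(width _) IHw.
by rewrite flatten_odd_peaks_cons npk /width /= -/(width _) IHw.
Qed.

Lemma schroder_flatten (h : int) (w : seq step) :
  all schroder_step (flatten_odd_peaks h w) = all schroder_step w.
Proof.
elim/flatten_odd_peaks_ind: h / w => [//|h w oddh IHw|h s w npk IHw].
  by rewrite /= oddh.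
by rewrite flatten_odd_peaks_cons npk /= IHw.
Qed.

(** * Expansion into blocks of width two and its inverse *)

Definition expand (w : seq step) : seq step := flatten (map expand_step w).

Lemma expand_cons (s : step) (w : seq step) :
  expand (s :: w) = expand_step s ++ expand w.
Proof. by []. Qed.

(** Labels are written with [inord], the form in which [contract] produces them. *)
Variant motzkin_step_spec : step -> seq step -> Type :=
  | StepU : motzkin_step_spec U [:: U; U]
  | StepD : motzkin_step_spec D [:: D; D]
  | StepH0 : motzkin_step_spec (H (inord 0)) [:: H2]
  | StepH1 : motzkin_step_spec (H (inord 1)) [:: D; U]
  | StepH2 : motzkin_step_spec (H (inord 2)) [:: U; D].

Lemma motzkin_stepP (s : step) :
  motzkin_step s -> motzkin_step_spec s (expand_step s).
Proof.
case: s => [||i|] // _; try by constructor.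
rewrite -[i]inord_val /=.
case: i => [[|[|[|//]]]] /= lt_i; rewrite inordK //; constructor.
Qed.

Lemma expandK (w : seq step) :
  all motzkin_step w -> contract (expand w ++ [:: D]) = w.
Proof.
elim: w => [//|s w IHw] /= /andP[/motzkin_stepP ms /IHw {}IHw].
by rewrite expand_cons -catA; case: ms => /=; rewrite IHw.
Qed.

Lemma width_expand (w : seq step) :
  all motzkin_step w -> width (expand w ++ [:: D]) = (2 * width w).+1.
Proof.
elim: w => [//|s w IHw] /= /andP[/motzkin_stepP ms /IHw {}IHw].
rewrite expand_cons -catA; case: ms; rewrite /width /= -!/(width _) IHw; lia.
Qed.

Lemma schroder_expand (w : seq step) :
  all motzkin_step w -> all schroder_step (expand w ++ [:: D]).
Proof.
elim: w => [//|s w IHw] /= /andP[/motzkin_stepP ms /IHw {}IHw].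
by rewrite expand_cons -catA; case: ms => /=; rewrite IHw.
Qed.

(** The offset 1 from the initial [U] gives a block [DU] room to dip to [2h], while [DD] from
    ordinate 1 fails exactly as [D] does from 0. The closing [D] reaches 0 only from [h = 0]. *)
Lemma descends_expand (h : nat) (w : seq step) :
  all motzkin_step w ->
  descends_from h.*2.+1 (expand w ++ [:: D]) = descends_from h w.
Proof.
elim: w h => [|s w IHw] h /=; first by rewrite double_eq0.
case/andP=> /motzkin_stepP ms /IHw {}IHw.
rewrite expand_cons -catA; case: ms => //=; first by rewrite -IHw.
by case: h => // h; rewrite -IHw.
Qed.

Lemma no_even_H2_expand (h : int) (w : seq step) :
  all motzkin_step w -> odd `|h|%N -> no_even_H2 h (expand w ++ [:: D]).
Proof.
elim: w h => [//|s w IHw] h /= /andP[/motzkin_stepP ms mw] oddh.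
rewrite expand_cons -catA.
by case: ms => /=; rewrite ?oddh /rise /=; apply: IHw => //; lia.
Qed.

Lemma motzkin_contract (w : seq step) : all motzkin_step (contract w).
Proof.
have [m] := ubnP (size w); elim: m w => // m IHm.
case=> [|[||i|] w] //=; last exact: IHm.
all: by case: w => [|[||j|] w] //= /ltnSE ltwm; apply/IHm/ltnW.
Qed.

(** Every block starts at an odd ordinate, so an [H2] can only open a block: after a single [U] or
    [D] it would have even height. Likewise the word can end in mid-block only with the closing
    [D]. *)
Lemma contractK (h : nat) (w : seq step) :
  all schroder_step w -> descends_from h.*2.+1 w -> no_even_H2 h.*2.+1%:Z w ->
  expand (contract w) ++ [:: D] = w.
Proof.
have [m] := ubnP (size w); elim: m w h => // m IHm w h.
case: w => [//|[||i|] w] //=; last first.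
  rewrite ltnS /rise /= addr0 => ltwm sw dw /andP[_ ew].
  by rewrite expand_cons /= inordK //= (IHm _ h).
all: case: w => [|[||j|] w] //= /ltnSE ltwm sw.
- move=> dw; rewrite /rise /= addrNK => ew.
  by rewrite expand_cons /= inordK //= (IHm _ h) //; exact: ltnW.
- case: h => // h dw; rewrite /rise /= => ew.
  by rewrite -/(expand (contract w)) (IHm _ h) //; exact: ltnW.
- by move=> _ /andP[]; lia.
- move=> dw; rewrite /rise /= => ew.
  rewrite -/(expand (contract w)) (IHm _ h.+1) //; first exact: ltnW.
  by move: ew; congr no_even_H2; lia.
- move=> dw; rewrite /rise /= addrK => ew.
  by rewrite expand_cons /= inordK //= (IHm _ h) //; exact: ltnW.
- by move=> _ /andP[]; lia.
Qed.

(** * Injectivity and surjectivity of the map *)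

Lemma gK (n : nat) (w : seq step) :
  MOT3 n w -> contract (behead (unflatten 0 (g w))) = w.
Proof.
case=> _ mw; rewrite /g -/(expand w) flattenK /= ?expandK //.
exact: no_even_H2_expand.
Qed.

Theorem theorem2p2 (n : nat) : set_bij (MOT3 n) (SCHodd n.+1) g.
Proof.
split.
- move=> w [/lattice_pathE[wn dw] mw]; apply/SCHoddE.
  rewrite /g -/(expand w); split.
  + by rewrite width_flatten /width /= -/(width _) width_expand // wn; lia.
  + by rewrite (descends_flatten 0) /= (descends_expand 0).
  + by rewrite schroder_flatten /= schroder_expand.
  + exact: no_odd_peak_flatten.
- by move=> v w /set_mem/gK vK /set_mem/gK wK eq_g; rewrite -vK eq_g.
- move=> s /SCHoddE[sn ds ss ps].
  (* The nonempty path [s] starts with [U] or with [H2]; the latter has height 0, which is even, so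
     it is turned into [UD]. *)
  have [w wE] : exists w, unflatten 0 s = U :: w.
    case: s sn ds ss {ps} => [|[||i|] s] //= _ _ _; last by eexists.
    by eexists.
  have fw : flatten_odd_peaks 0 (U :: w) = s by rewrite -wE unflattenK.
  have /= ew := no_even_H2_unflatten 0 s; rewrite wE /= in ew.
  move: ds sn ss; rewrite -fw (descends_flatten 0) width_flatten.
  rewrite schroder_flatten /width /= -/(width _) => dw wn sw.
  have mc := motzkin_contract w.
  (* After the initial [U], the word [w] starts at ordinate 1, the case [h = 0]. *)
  have cK : expand (contract w) ++ [:: D] = w by exact: (@contractK 0).
  exists (contract w); last by rewrite /g -/(expand _) cK.
  split=> //; apply/lattice_pathE; split.
    by move: wn; rewrite -{1}cK width_expand //; lia.
  by rewrite -(descends_expand 0) // cK.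
Qed.
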